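(* Let $((A,\mu),(M,l,r),T)$ be a relative Rota-Baxter algebra over a field $\mathbb K$ of characteristic $0$. There is a bijective correspondence between the equivalence classes of infinitesimal deformations of $((A,\mu),(M,l,r),T)$ and the cohomology classes in the second cohomology space $H^2(A,M,T)$.
   Context: Relative Rota-Baxter algebra: an associative algebra $(A,\mu)$, an $A$-bimodule $(M,l,r)$ (left action $l$, right action $r$) and a linear map $T:M\to A$ with $T(m)T(n)=T(T(m)n+mT(n))$. A morphism $(\varphi,\psi):(A,M,T)\to(A',M',T')$ is an algebra homomorphism $\varphi:A\to A'$ and a linear map $\psi:M\to M'$ with $T'\psi=\varphi T$, $\psi(am)=\varphi(a)\psi(m)$, $\psi(ma)=\psi(m)\varphi(a)$; it is an isomorphism if $\varphi,\psi$ are bijective. The same notions make sense over a commutative ring $\mathsf R$. Infinitesimal deformation: let $\mathsf R=\mathbb K[[t]]/(t^2)$ with augmentation $\epsilon:\mathsf R\to\mathbb K$, $\epsilon(f)=f(0)$. It is an $\mathsf R$-relative Rota-Baxter algebra $((\mathsf R\otimes_{\mathbb K}A,\mu_{\mathsf R}),(\mathsf R\otimes_{\mathbb K}M,l_{\mathsf R},r_{\mathsf R}),T_{\mathsf R})$ such that $(\epsilon\otimes\mathrm{id}_A,\epsilon\otimes\mathrm{id}_M)$ is a morphism of $\mathsf R$-relative Rota-Baxter algebras to $((A,\mu),(M,l,r),T)$, with $\mathsf R$ acting on $A,M$ through $\epsilon$. Two infinitesimal deformations are equivalent if there is an isomorphism $(\Phi,\Psi)$ of $\mathsf R$-relative Rota-Baxter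 algebras between them with $(\epsilon\otimes\mathrm{id}_A)\circ\Phi=\epsilon\otimes\mathrm{id}_A$ and $(\epsilon\otimes\mathrm{id}_M)\circ\Psi=\epsilon\otimes\mathrm{id}_M$. An infinitesimal deformation has the form $\mu_{\mathsf R}=\mu+t\mu_1$, $l_{\mathsf R}=l+tl_1$, $r_{\mathsf R}=r+tr_1$, $T_{\mathsf R}=T+tT_1$, and the correspondence sends its class to the class of $(\mu_1+l_1+r_1,T_1)$. Cochain complex: let $\pi=\mu+l+r$ on $V=A\oplus M$ (maps extended by zero). Gerstenhaber bracket: for $f\in\mathrm{Hom}(V^{\otimes m+1},V)$, $g\in\mathrm{Hom}(V^{\otimes n+1},V)$, $(f\diamond g)(v_1,\ldots,v_{m+n+1})=\sum_{i=1}^{m+1}(-1)^{(i-1)n}f(v_1,\ldots,v_{i-1},g(v_i,\ldots,v_{i+n}),\ldots,v_{m+n+1})$, $[f,g]=f\diamond g-(-1)^{mn}g\diamond f$. Let $\mathcal A^{n-1,1}$ be the direct sum of all tensor products of $n-1$ copies of $A$ and one of $M$ in any order. Then $C^0(A,M,T)=0$, $C^1(A,M,T)=\mathrm{Hom}(A,A)\oplus\mathrm{Hom}(M,M)$, and for $n\ge2$, $C^n(A,M,T)=\mathrm{Hom}(A^{\otimes n},A)\oplus\mathrm{Hom}(\mathcal A^{n-1,1},M)\oplus\mathrm{Hom}(M^{\otimes n-1},A)$. For $f\in\mathrm{Hom}(A^{\otimes n},A)\oplus\mathrm{Hom}(\mathcal A^{n-1,1},M)$ and $P\in\mathrm{Hom}(M^{\otimes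 n-1},A)$ ($P$ absent if $n=1$), $\mathcal D(f,P)=\big((-1)^{n-1}[\pi,f],\,(-1)^n[[\pi,T],P]+\Omega f\big)$, where $(\Omega f)(u_1,\ldots,u_n)=(-1)^n\big(f(Tu_1,\ldots,Tu_n)-\sum_{i=1}^nT f(Tu_1,\ldots,u_i,\ldots,Tu_n)\big)$ for $u_j\in M$ (with $u_i$ in the $i$-th slot not hit by $T$). One has $\mathcal D^2=0$, and $H^\bullet(A,M,T)$ is the cohomology of $(C^\bullet(A,M,T),\mathcal D)$. *)

(* Defs.v *)
From HB Require Import structures.
From mathcomp Require Import all_boot all_order all_algebra.
From mathcomp Require Import sesquilinear qpoly.
From mathcomp Require Import boolp classical_sets functions.

Set Implicit Arguments.
Unset Strict Implicit.
Unset Printing Implicit Defensive.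

Import GRing.Theory.
Local Open Scope ring_scope.
Local Open Scope classical_set_scope.

(* Algebras are not assumed to be unital. *)
Record rel_rota_baxter (R : comNzRingType) (A M : lmodType R) := RelRotaBaxter {
  rb_mul : A -> A -> A;
  rb_lact : A -> M -> M;
  rb_ract : M -> A -> M;
  rb_op : M -> A;
  rb_mul_bilinear : bilinear_for *:%R *:%R rb_mul;
  rb_lact_bilinear : bilinear_for *:%R *:%R rb_lact;
  rb_ract_bilinear : bilinear_for *:%R *:%R rb_ract;
  rb_op_linear : linear rb_op;
  rb_mulA : forall a b c, rb_mul (rb_mul a b) c = rb_mul a (rb_mul b c);
  rb_lactA : forall a b m, rb_lact (rb_mul a b) m = rb_lact a (rb_lact b m);
  rb_lractA : forall a m b,
    rb_ract (rb_lact a m) b = rb_lact a (rb_ract m b);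
  rb_ractA : forall m a b, rb_ract (rb_ract m a) b = rb_ract m (rb_mul a b);
  rb_opE : forall m n, rb_mul (rb_op m) (rb_op n) =
    rb_op (rb_lact (rb_op m) n + rb_ract m (rb_op n))
}.

Definition rb_morphism (R : comNzRingType) (A M A' M' : lmodType R)
    (S : rel_rota_baxter A M) (S' : rel_rota_baxter A' M')
    (phi : A -> A') (psi : M -> M') : Prop :=
  [/\ linear phi /\ linear psi,
      forall a b, phi (rb_mul S a b) = rb_mul S' (phi a) (phi b),
      forall m, rb_op S' (psi m) = phi (rb_op S m),
      forall a m, psi (rb_lact S a m) = rb_lact S' (phi a) (psi m)
    & forall m a, psi (rb_ract S m a) = rb_ract S' (psi m) (phi a)].

Definition rb_isomorphism (R : comNzRingType) (A M A' M' : lmodType R)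
    (S : rel_rota_baxter A M) (S' : rel_rota_baxter A' M')
    (phi : A -> A') (psi : M -> M') : Prop :=
  [/\ rb_morphism S S' phi psi, bijective phi & bijective psi].

(* K[[t]]/(t^2) = K[t]/(t^2); the elements are the polynomials f`_0 + f`_1 t. *)
Notation dual_numbers K := {poly %/ ('X^2 : {poly K})}.

Section DualCoefficients.
Variable K : fieldType.
Implicit Types f g : dual_numbers K.

Lemma size_dual f : (size f <= 2)%N.
Proof. by rewrite (leq_trans (size_npoly f))// mk_monic_Xn size_polyXn. Qed.

Lemma dualP f g : f`_0 = g`_0 -> f`_1 = g`_1 -> f = g.
Proof.
move=> e0 e1; apply/npolyP => -[|[|i]] //.
by rewrite !nth_default// (leq_trans (size_dual _)).
Qed.

Lemma coef_dual1 i : (1 : dual_numbers K)`_i = (i == 0)%:R.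
Proof. by rewrite [LHS](_ : _ = (1 : {poly K})`_i)// coef1. Qed.

Lemma coef_dualD f g i : (f + g)`_i = f`_i + g`_i.
Proof. by rewrite [LHS](_ : _ = ((f : {poly K}) + g)`_i)// coefD. Qed.

Lemma coef_dualM f g i : (i < 2)%N ->
  (f * g)`_i = \sum_(j < i.+1) f`_j * g`_(i - j).
Proof.
move=> i2; rewrite poly_of_qpolyM -coefM.
have modE (p : {poly K}) :
    (Pdiv.CommonRing.rmodp p (mk_monic ('X^2 : {poly K})))`_i = p`_i.
  rewrite mk_monic_Xn/= [in RHS](Pdiv.RingMonic.rdivp_eq (monicXn K 2) p).
  by rewrite coefD coefMXn i2 add0r.
exact: modE.
Qed.

Lemma coef_dualM0 f g : (f * g)`_0 = f`_0 * g`_0.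
Proof. by rewrite coef_dualM// big_ord1. Qed.

Lemma coef_dualM1 f g : (f * g)`_1 = f`_0 * g`_1 + f`_1 * g`_0.
Proof. by rewrite coef_dualM// big_ord_recr big_ord1. Qed.

End DualCoefficients.

(* R (x)_K E for R = K[[t]]/(t^2): the pair (x, y) stands for 1 (x) x + t (x) y.
   The universal property is dual_ext_universal below. *)
Definition dual_ext (K : fieldType) (E : lmodType K) : Type := (E * E)%type.

(* E, with R acting through the augmentation f |-> f(0). *)
Definition dual_aug (K : fieldType) (E : lmodType K) : Type := E.

Section DualModules.
Variables (K : fieldType) (E : lmodType K).

HB.instance Definition _ := GRing.Zmodule.copy (dual_ext E) (E * E)%type.
HB.instance Definition _ := GRing.Zmodule.copy (dual_aug E) E.

Definition dual_ext_scale (f : dual_numbers K) (x : dual_ext E) : dual_ext E :=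
  (f`_0 *: x.1, f`_0 *: x.2 + f`_1 *: x.1).

Fact dual_ext_scaleA f g x :
  dual_ext_scale f (dual_ext_scale g x) = dual_ext_scale (f * g) x.
Proof.
rewrite /dual_ext_scale coef_dualM0 coef_dualM1 /=; congr pair.
  by rewrite scalerA.
by rewrite scalerDr !scalerA scalerDl addrA.
Qed.
Fact dual_ext_scale1 : left_id 1 dual_ext_scale.
Proof.
by case=> x y; rewrite /dual_ext_scale !coef_dual1/= !scale1r scale0r addr0.
Qed.
Fact dual_ext_scaleDr : right_distributive dual_ext_scale +%R.
Proof.
move=> f x y; rewrite /dual_ext_scale /=; congr pair; first exact: scalerDr.
by rewrite !scalerDr addrACA.
Qed.
Fact dual_ext_scaleDl x : {morph dual_ext_scale^~ x : f g / f + g}.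
Proof.
move=> f g; rewrite /dual_ext_scale !coef_dualD; congr pair.
  exact: scalerDl.
by rewrite !scalerDl addrACA.
Qed.
HB.instance Definition _ :=
  GRing.Zmodule_isLmodule.Build (dual_numbers K) (dual_ext E)
    dual_ext_scaleA dual_ext_scale1 dual_ext_scaleDr dual_ext_scaleDl.

Definition dual_aug_scale (f : dual_numbers K) (x : dual_aug E) : dual_aug E :=
  f`_0 *: (x : E).

Fact dual_aug_scaleA f g x :
  dual_aug_scale f (dual_aug_scale g x) = dual_aug_scale (f * g) x.
Proof. by rewrite /dual_aug_scale coef_dualM0 scalerA. Qed.
Fact dual_aug_scale1 : left_id 1 dual_aug_scale.
Proof. by move=> x; rewrite /dual_aug_scale coef_dual1 scale1r. Qed.
Fact dual_aug_scaleDr : right_distributive dual_aug_scale +%R.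
Proof. by move=> f x y; apply: scalerDr. Qed.
Fact dual_aug_scaleDl x : {morph dual_aug_scale^~ x : f g / f + g}.
Proof. by move=> f g; rewrite /dual_aug_scale coef_dualD; apply: scalerDl. Qed.
HB.instance Definition _ :=
  GRing.Zmodule_isLmodule.Build (dual_numbers K) (dual_aug E)
    dual_aug_scaleA dual_aug_scale1 dual_aug_scaleDr dual_aug_scaleDl.

Definition dual_tensor (f : dual_numbers K) (x : E) : dual_ext E :=
  (f`_0 *: x, f`_1 *: x).

Lemma dual_tensorZ (f g : dual_numbers K) x :
  f *: dual_tensor g x = dual_tensor (f * g) x.
Proof.
rewrite /dual_tensor coef_dualM0 coef_dualM1; congr pair => /=.
  exact: scalerA.
by rewrite !scalerA scalerDl.
Qed.

Lemma dual_ext_universal (W : lmodType K) (b : dual_numbers K -> E -> W) :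
    bilinear_for *:%R *:%R b ->
  exists! h : E * E -> W,
    linear h /\ forall f x, h (dual_tensor f x) = b f x.
Proof.
move=> [bl br].
have blD x : {morph b^~ x : f g / f + g}.
  by move=> f g /=; have := bl x 1 f g; rewrite /= !scale1r.
have bl0 x : b 0 x = 0.
  by apply: (addrI (b 0 x)); rewrite -blD !addr0.
have blZ x c f : b (c *: f) x = c *: b f x.
  by have := bl x c f 0; rewrite /= bl0 !addr0.
have T0 : ('qX : dual_numbers K)`_0 = 0.
  by rewrite qpolyXE ?monicXn ?size_polyXn// coefX.
have T1 : ('qX : dual_numbers K)`_1 = 1.
  by rewrite qpolyXE ?monicXn ?size_polyXn// coefX.
exists (fun x => b 1 x.1 + b 'qX x.2); split.
  split=> [c x y|f x] /=.
    by rewrite !br scalerDr addrACA.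
  have brZ g c y : b g (c *: y) = c *: b g y.
    have br0 : b g 0 = 0.
      have := br g 1 0 0; rewrite /= !scale1r !addr0 => h.
      by apply: (addrI (b g 0)); rewrite addr0 -h.
    by have := br g c y 0; rewrite /= br0 !addr0.
  rewrite !brZ -!blZ -blD; congr (b _ x).
  have coefZd c (g : dual_numbers K) i : (c *: g)`_i = c * g`_i.
    by rewrite [LHS](_ : _ = (c *: (g : {poly K}))`_i)// coefZ.
  by apply: dualP; rewrite coef_dualD !coefZd coef_dual1 ?T0 ?T1/=
    !(mulr0, mulr1, addr0, add0r).
move=> h [hl hb]; apply/funext => -[x y] /=.
rewrite -!hb /dual_tensor !coef_dual1 T0 T1 /= !scale1r !scale0r.
have := hl 1 (x, 0) (0, y); rewrite /= !scale1r => <-; congr h.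
by congr pair; rewrite ?addr0 ?add0r.
Qed.

(* epsilon (x) id. *)
Definition dual_eps (x : dual_ext E) : dual_aug E := x.1.

Lemma dual_eps_tensor f x : dual_eps (dual_tensor f x) = f`_0 *: x.
Proof. by []. Qed.

End DualModules.

Section Deformations.
Variables (K : fieldType) (A M : lmodType K).

Fact dual_aug_linear (E F : lmodType K) (h : E -> F) :
  linear h -> linear (h : dual_aug E -> dual_aug F).
Proof. by move=> hl f; apply: hl. Qed.

Fact dual_aug_bilinear (E F G : lmodType K) (h : E -> F -> G) :
  bilinear_for *:%R *:%R h ->
  bilinear_for *:%R *:%R (h : dual_aug E -> dual_aug F -> dual_aug G).
Proof. by move=> [hl hr]; split=> [x f|x f]; [apply: hl|apply: hr]. Qed.

(* The same structure maps, seen over R through the augmentation. *)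
Definition rb_aug (S : rel_rota_baxter A M) :
    rel_rota_baxter (dual_aug A) (dual_aug M) :=
  @RelRotaBaxter (dual_numbers K) (dual_aug A) (dual_aug M)
    (rb_mul S) (rb_lact S) (rb_ract S) (rb_op S)
    (dual_aug_bilinear (rb_mul_bilinear S))
    (dual_aug_bilinear (rb_lact_bilinear S))
    (dual_aug_bilinear (rb_ract_bilinear S))
    (dual_aug_linear (rb_op_linear S))
    (@rb_mulA _ _ _ S) (@rb_lactA _ _ _ S) (@rb_lractA _ _ _ S)
    (@rb_ractA _ _ _ S) (@rb_opE _ _ _ S).

Record inf_deformation (S : rel_rota_baxter A M) := InfDeformation {
  defo_rb :> rel_rota_baxter (dual_ext A) (dual_ext M);
  defo_eps : rb_morphism defo_rb (rb_aug S) (@dual_eps K A) (@dual_eps K M)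
}.

Definition defo_equiv (S : rel_rota_baxter A M)
    (D D' : inf_deformation S) : Prop :=
  exists Phi Psi, [/\ rb_isomorphism D D' Phi Psi,
    forall x, dual_eps (Phi x) = dual_eps x
  & forall x, dual_eps (Psi x) = dual_eps x].

End Deformations.

(* Hom(V^{(x) n}, W) is the set of the maps ('I_n -> V) -> W that are
   multilinear. *)
Definition multilinear (K : fieldType) (V W : lmodType K) n
    (f : ('I_n -> V) -> W) : Prop :=
  forall (v : 'I_n -> V) (i : 'I_n), linear (fun x : V => f (@dfwith _ _ v i x)).

Section Gerstenhaber.
Variables (K : fieldType) (V : lmodType K).

(* Arguments and insertion positions are numbered from 0. *)
Definition gcirc m n (f : ('I_m.+1 -> V) -> V) (g : ('I_n.+1 -> V) -> V) :
    ('I_(m + n).+1 -> V) -> V :=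
  fun v => \sum_(i < m.+1) (-1) ^+ (i * n) *:
    f (fun j : 'I_m.+1 =>
         if (j < i)%N then v (inord j)
         else if j == i then g (fun k : 'I_n.+1 => v (inord (i + k)))
         else v (inord (j + n))).

Definition gbracket m n (f : ('I_m.+1 -> V) -> V) (g : ('I_n.+1 -> V) -> V) :
    ('I_(m + n).+1 -> V) -> V :=
  fun v => gcirc f g v -
    (-1) ^+ (m * n) *: gcirc g f (v \o cast_ord (congr1 S (addnC n m))).

End Gerstenhaber.

Section Complex.
Variables (K : fieldType) (A M : lmodType K).
Local Notation V := (A * M)%type.

Definition inA (a : A) : V := (a, 0).
Definition inM (m : M) : V := (0, m).

(* f lies in Hom(A^{(x) n}, A) (+) Hom(A^{n-1,1}, M), viewed inside
   Hom(V^{(x) n}, V): f is the extension by zero of its restrictions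
   A^{(x) n} -> A and A (x) .. (x) M (x) .. (x) A -> M, with M in position i. *)
Definition degree0 n (f : ('I_n -> V) -> V) : Prop :=
  forall v, f v =
    ((f (fun j => inA (v j).1)).1,
     \sum_(i < n) (f (fun j => if j == i then inM (v j).2
                               else inA (v j).1)).2).

Definition cochain n : Type :=
  ((('I_n -> V) -> V) * (('I_n.-1 -> M) -> A))%type.

(* C^0 = 0, and in C^1 there is no component P. *)
Definition cochains n : set (cochain n) :=
  match n with
  | 0 => [set 0]
  | 1 => [set c | [/\ multilinear c.1, degree0 c.1 & c.2 = 0]]
  | _ => [set c | [/\ multilinear c.1, degree0 c.1 & multilinear c.2]]
  end.

Variable S : rel_rota_baxter A M.
Local Notation T := (rb_op S).

(* pi = mu + l + r, extended by zero. *)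
Definition pi_map : ('I_2 -> V) -> V := fun v =>
  let x := v ord0 in let y := v ord_max in
  (rb_mul S x.1 y.1, rb_lact S x.1 y.2 + rb_ract S x.2 y.1).

(* T and P in Hom(V^{(x) n}, V), extended by zero. *)
Definition op_map : ('I_1 -> V) -> V := fun v => inA (T (v ord0).2).
Definition extM n (P : ('I_n -> M) -> A) : ('I_n -> V) -> V :=
  fun v => inA (P (fun j => (v j).2)).

(* [[pi, T], P], restricted to M^{(x) n} -> A; 0 when P is absent. *)
Definition derived_bracket n :
    (('I_n -> M) -> A) -> ('I_n.+1 -> M) -> A :=
  match n with
  | 0 => fun _ _ => 0
  | _.+1 => fun P u =>
      (gbracket (gbracket pi_map op_map) (extM P) (fun j => inM (u j))).1
  end.

Definition Omega n (f : ('I_n -> V) -> V) : ('I_n -> M) -> A := fun u =>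
  (-1) ^+ n *:
    ((f (fun j => inA (T (u j)))).1 -
     \sum_(i < n) T (f (fun j => if j == i then inM (u j)
                                 else inA (T (u j)))).2).

Definition rb_diff n : cochain n -> cochain n.+1 :=
  match n with
  | 0 => fun _ => 0
  | k.+1 => fun c =>
      ((fun v => (-1) ^+ k *: gbracket pi_map c.1 v),
       (fun u => (-1) ^+ k.+1 *: derived_bracket c.2 u + Omega c.1 u))
  end.

Definition cocycles n : set (cochain n) :=
  [set c | cochains c /\ rb_diff c = 0].

Definition coboundaries n : set (cochain n) :=
  match n with
  | 0 => [set 0]
  | k.+1 => @rb_diff k @` @cochains k
  end.

Definition cohomologous n (c c' : cochain n) : Prop := coboundaries (c - c').

End Complex.

Section Quotients.
Variables (T : Type) (Z : set T) (E : T -> T -> Prop).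

Definition eq_class (x : T) : set T := [set y | Z y /\ E x y].

Definition eq_classes : Type := {C : set T | exists2 x, Z x & C = eq_class x}.

End Quotients.

Section Classes.
Variables (K : fieldType) (A M : lmodType K) (S : rel_rota_baxter A M).

Definition deformation_classes : Type :=
  eq_classes [set: inf_deformation S] (@defo_equiv K A M S).

Definition defo_class (D : inf_deformation S) : deformation_classes :=
  exist _ (eq_class setT (@defo_equiv K A M S) D)
    (ex_intro2 _ _ D Logic.I erefl).

Definition cohomology n : Type := eq_classes (@cocycles K A M S n)
                                             (@cohomologous K A M S n).

Definition coho_class n (c : cochain A M n) (cZ : cocycles S c) :
    cohomology n :=
  exist _ (eq_class (@cocycles K A M S n) (@cohomologous K A M S n) c)
    (ex_intro2 _ _ c cZ erefl).

End Classes.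

(* (mu_1 + l_1 + r_1, T_1), where mu_1, l_1, r_1, T_1 are the coefficients of t
   in the structure maps of the deformation applied to elements 1 (x) x. *)
Definition infinitesimal (K : fieldType) (A M : lmodType K)
    (S : rel_rota_baxter A M) (D : inf_deformation S) : cochain A M 2 :=
  let one (E : lmodType K) (x : E) : dual_ext E := dual_tensor 1 x in
  ((fun v => let x := v ord0 in let y := v ord_max in
     ((rb_mul D (one A x.1) (one A y.1)).2,
      (rb_lact D (one A x.1) (one M y.2)).2
      + (rb_ract D (one M x.2) (one A y.1)).2)),
   (fun u => (rb_op D (one M (u ord0))).2)).

(* Main.v *)
Require Import Defs.
From HB Require Import structures.
From mathcomp Require Import all_boot all_order all_algebra.
From mathcomp Require Import sesquilinear qpoly.
From mathcomp Require Import boolp classical_sets functions.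
Import GRing.Theory.
Local Open Scope ring_scope.

Set Implicit Arguments.
Unset Strict Implicit.
Unset Printing Implicit Defensive.

(* Writing [1 (x) x + t (x) y] as the pair [(x, y)], a map over the dual numbers
   lifting [h0] along the augmentation is [(x, y) |-> (h0 x, h1 x + h0 y)] with
   [h1] its infinitesimal part, and similarly for bilinear maps.  Taking the
   coefficients of [t], the axioms of a relative Rota-Baxter algebra become the
   vanishing of [D (mu_1 + l_1 + r_1, T_1)], and the conditions on an
   equivalence [(id + t phi, id + t psi)] become that the difference of the
   two infinitesimals is [D (phi + psi)].  So the infinitesimal is a surjection
   from deformations onto 2-cocycles which reflects and preserves the two
   equivalence relations. *)

(** * Identities in abelian groups by reflection *)

Inductive zexpr := ZVar of nat | ZZero | ZAdd of zexpr & zexpr | ZOpp of zexpr.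

Fixpoint zeval (V : zmodType) (s : seq V) (e : zexpr) : V :=
  match e with
  | ZVar i => s`_i
  | ZZero => 0
  | ZAdd e1 e2 => zeval s e1 + zeval s e2
  | ZOpp e1 => - zeval s e1
  end.

Fixpoint zcoef (e : zexpr) (i : nat) : int :=
  match e with
  | ZVar j => if j == i then 1 else 0
  | ZZero => 0
  | ZAdd e1 e2 => zcoef e1 i + zcoef e2 i
  | ZOpp e1 => - zcoef e1 i
  end.

(** Collecting the occurrences of each atom gives a normal form, an integer combination of the
    atoms. A variable beyond the end of the list evaluates to the default 0, so it may be left out
    of the sum. *)
Lemma zeval_sum (V : zmodType) (s : seq V) (e : zexpr) :
  zeval s e = \sum_(i < size s) s`_i *~ zcoef e i.
Proof.
elim: e => [j||e1 IH1 e2 IH2|e1 IH1] /=.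
- have [ltj|lej] := ltnP j (size s).
    rewrite (bigD1 (Ordinal ltj)) //= eqxx mulr1z big1 ?addr0// => i neq.
    by case: eqP => [eji|_]; rewrite ?mulr0z//; case/eqP: neq; apply/val_inj.
  rewrite nth_default// big1// => i _.
  by case: eqP => [eji|_]; rewrite ?mulr0z// nth_default ?mul0rz// -eji.
- by rewrite big1// => i _; rewrite mulr0z.
- by rewrite IH1 IH2 -big_split; apply: eq_bigr => i _; rewrite mulrzDr.
- by rewrite IH1 -sumrN; apply: eq_bigr => i _; rewrite mulrNz.
Qed.

(** The premise is a closed boolean computation on integer coefficients, so [isT] proves it by
    conversion. *)
Lemma zeval_eq (V : zmodType) (s : seq V) (e e' : zexpr) :
  all (fun i => zcoef e i == zcoef e' i) (iota 0 (size s)) ->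
  zeval s e = zeval s e'.
Proof.
move=> /allP h; rewrite !zeval_sum; apply: eq_bigr => i _.
by rewrite (eqP (h i _))// mem_iota ltn_ord.
Qed.

(* Atoms are compared up to conversion, because the same scaling can occur with
   different instance paths. *)
Ltac zmem x s :=
  match s with
  | nil => constr:(false)
  | cons ?y _ => let _ := constr:(erefl : x = y) in constr:(true)
  | cons _ ?s' => zmem x s'
  end.

Ltac zvars t s :=
  lazymatch t with
  | ?a + ?b => let s' := zvars a s in zvars b s'
  | - ?a => zvars a s
  | 0 => s
  | _ => lazymatch zmem t s with true => s | false => constr:(t :: s) end
  end.

Ltac zindex x s :=
  match s with
  | cons ?y _ => let _ := constr:(erefl : x = y) in constr:(0%N)
  | cons _ ?s' => let n := zindex x s' in constr:(S n)
  end.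

Ltac zreify t s :=
  lazymatch t with
  | ?a + ?b => let e := zreify a s in let e' := zreify b s in constr:(ZAdd e e')
  | - ?a => let e := zreify a s in constr:(ZOpp e)
  | 0 => constr:(ZZero)
  | _ => let n := zindex t s in constr:(ZVar n)
  end.

(* Decides identities between sums and opposites in an abelian group. *)
Ltac abel :=
  lazymatch goal with
  | |- @eq ?T ?x ?y =>
    let s := zvars x (@nil T) in
    let s := zvars y s in
    let e := zreify x s in
    let e' := zreify y s in
    exact: (@zeval_eq _ s e e' isT)
  end.

(** Reduces a goal that follows from a known equation by cancellation to an unconditional identity,
    which is what [abel] can close. *)
Lemma eq_of_subr (V : zmodType) (a b x y : V) : a = b -> x - y = a - b -> x = y.
Proof. by move=> -> /eqP; rewrite subrr subr_eq0 => /eqP. Qed.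

(** * Rewriting rules for linear and bilinear maps *)

Section Rules.
Variable R : comNzRingType.

(** The rules form one product, so that a single rewrite pushes the map through every module
    operation. *)
Lemma linear_rules (U V : lmodType R) (f : U -> V) : linear f ->
  (f 0 = 0) * (forall x y, f (x + y) = f x + f y) *
  (forall x, f (- x) = - f x) * (forall a x, f (a *: x) = a *: f x).
Proof.
move=> fl.
have fD x y : f (x + y) = f x + f y.
  by have := fl 1 x y; rewrite !scale1r.
have f0 : f 0 = 0 by apply: (addrI (f 0)); rewrite -fD !addr0.
have fN x : f (- x) = - f x by apply: (addrI (f x)); rewrite -fD !subrr.
split=> //.
by move=> a x; have := fl a x 0; rewrite f0 !addr0.
Qed.

Lemma bilinear_rules (U U' V : lmodType R) (b : U -> U' -> V) :
  bilinear_for *:%R *:%R b ->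
  (forall y, b 0 y = 0) * (forall x, b x 0 = 0) *
  (forall x x' y, b (x + x') y = b x y + b x' y) *
  (forall x y y', b x (y + y') = b x y + b x y') *
  (forall x y, b (- x) y = - b x y) * (forall x y, b x (- y) = - b x y) *
  (forall a x y, b (a *: x) y = a *: b x y) *
  (forall a x y, b x (a *: y) = a *: b x y).
Proof.
move=> [bl br].
have L y := linear_rules (bl y); have Rr x := linear_rules (br x).
by do !split=> *; rewrite ?L ?Rr.
Qed.

End Rules.

(** * Linear and bilinear maps over the dual numbers *)

Section DualMaps.
Variable K : fieldType.

Definition dual_lin (E F : lmodType K) (h0 h1 : E -> F) :
    dual_ext E -> dual_ext F :=
  fun X => (h0 X.1, h1 X.1 + h0 X.2).

Definition dual_bil (E F G : lmodType K) (b0 b1 : E -> F -> G) :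
    dual_ext E -> dual_ext F -> dual_ext G :=
  fun X Y => (b0 X.1 Y.1, b1 X.1 Y.1 + (b0 X.2 Y.1 + b0 X.1 Y.2)).

Local Notation one := (dual_tensor 1).

Lemma dual_oneE (E : lmodType K) (x : E) : one x = (x, 0).
Proof. by rewrite /dual_tensor !coef_dual1 /= scale1r scale0r. Qed.

Lemma dual_extP (E : lmodType K) (X Y : dual_ext E) :
  X.1 = Y.1 -> X.2 = Y.2 -> X = Y.
Proof. by case: X Y => [? ?] [? ?] /= -> ->. Qed.

Lemma coef_dualX i : ('qX : dual_numbers K)`_i = (i == 1)%:R.
Proof. by rewrite qpolyXE ?monicXn ?size_polyXn// coefX. Qed.

(** Here ['qX] is the class of t. Hence the elements [one x] generate the extended module, and a
    linear map over the dual numbers is determined by its values on them. *)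
Lemma dual_ext_decomp (E : lmodType K) (X : dual_ext E) :
  X = ('qX : dual_numbers K) *: one X.2 + one X.1.
Proof.
rewrite !dual_oneE; apply: dual_extP; rewrite /= !coef_dualX scale0r ?add0r//.
by rewrite scale1r addr0.
Qed.

Lemma dual_lin_linear (E F : lmodType K) (h0 h1 : E -> F) :
  linear h0 -> linear h1 -> linear (dual_lin h0 h1).
Proof.
move=> /linear_rules l0 /linear_rules l1 f X Y.
apply: dual_extP => /=; first by rewrite !l0.
by rewrite !l0 !l1 scalerDr; abel.
Qed.

Lemma dual_bil_bilinear (E F G : lmodType K) (b0 b1 : E -> F -> G) :
  bilinear_for *:%R *:%R b0 -> bilinear_for *:%R *:%R b1 ->
  bilinear_for *:%R *:%R (dual_bil b0 b1).
Proof.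
move=> /bilinear_rules l0 /bilinear_rules l1; split=> Z f X Y;
  (apply: dual_extP => /=; first by rewrite !l0);
  by rewrite !l0 !l1 !scalerDr; abel.
Qed.

(** In h(x + ty) = h(x) + t h(y) the factor t kills the coefficient of t in h(y), so only [h0 y]
    survives next to the infinitesimal part at x. *)
Lemma dual_linE (E F : lmodType K) (h : dual_ext E -> dual_ext F) (h0 : E -> F) :
  linear h -> (forall X, (h X).1 = h0 X.1) ->
  h = dual_lin h0 (fun x => (h (one x)).2).
Proof.
move=> hl he; apply/funext => X; apply: dual_extP; first exact: he.
have he1 x : (h (one x)).1 = h0 x by rewrite he dual_oneE.
rewrite [in LHS](dual_ext_decomp X) hl /= he1 !coef_dualX.
by rewrite scale0r add0r scale1r addrC.
Qed.

Lemma linear_dual_part (E F : lmodType K) (h : dual_ext E -> dual_ext F) :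
  linear h -> linear (fun x => (h (one x)).2).
Proof.
move=> hl a x y.
(* A scalar of K acts on the extended module as the constant dual number [a *: 1]. *)
have -> : one (a *: x + y) = (a *: 1 : dual_numbers K) *: one x + one y.
  by rewrite !dual_oneE; apply: dual_extP;
    rewrite /= !coefZ !coefC /= ?mulr1 ?mulr0 ?scale0r ?scaler0 ?addr0.
by rewrite hl /= !coefZ !coefC /= mulr1 mulr0 scale0r addr0.
Qed.

Lemma dual_bilE (E F G : lmodType K) (b : dual_ext E -> dual_ext F -> dual_ext G)
    (b0 : E -> F -> G) :
  bilinear_for *:%R *:%R b -> (forall X Y, (b X Y).1 = b0 X.1 Y.1) ->
  b = dual_bil b0 (fun x y => (b (one x) (one y)).2).
Proof.
move=> [bl br] be; apply/funext => X; apply/funext => Y.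
apply: dual_extP; first exact: be.
have be1 x Z : (b (one x) Z).1 = b0 x Z.1 by rewrite be dual_oneE.
(* The first variable is expanded with Y fixed. Only the term at [one X.1] still hides a coefficient
   of t, and it is then expanded in the second variable. *)
have -> := congr1 (fun h => (h X).2) (dual_linE (h0 := b0^~ Y.1) (bl Y) (be^~ Y)).
have /= -> := congr1 (fun h => (h Y).2) 
  (dual_linE (h0 := b0 X.1) (br (one X.1)) (be1 X.1)).
by abel.
Qed.

Lemma bilinear_dual_part (E F G : lmodType K)
    (b : dual_ext E -> dual_ext F -> dual_ext G) :
  bilinear_for *:%R *:%R b ->
  bilinear_for *:%R *:%R (fun x y => (b (one x) (one y)).2).
Proof.
by move=> [bl br]; split=> z;
  [exact: (linear_dual_part (bl (one z)))|exact: (linear_dual_part (br (one z)))].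
Qed.

(** Stated for four unrelated products so that associativity and the three bimodule axioms are all
    instances. Terms in which an argument carries the factor t cancel by the undeformed identity;
    what remains is the condition on the infinitesimal parts. *)
Lemma dual_bil_assoc (E F G H I J : lmodType K)
    (b0 b1 : E -> F -> H) (c0 c1 : H -> G -> J)
    (d0 d1 : F -> G -> I) (e0 e1 : E -> I -> J) :
  bilinear_for *:%R *:%R c0 -> bilinear_for *:%R *:%R e0 ->
  bilinear_for *:%R *:%R b0 -> bilinear_for *:%R *:%R d0 ->
  (forall x y z, c0 (b0 x y) z = e0 x (d0 y z)) ->
  (forall X Y Z, dual_bil c0 c1 (dual_bil b0 b1 X Y) Z =
                 dual_bil e0 e1 X (dual_bil d0 d1 Y Z)) <->
  (forall x y z, c1 (b0 x y) z + c0 (b1 x y) z =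
                 e1 x (d0 y z) + e0 x (d1 y z)).
Proof.
move=> /bilinear_rules lc /bilinear_rules le /bilinear_rules lb /bilinear_rules ld.
move=> assoc0; split=> [h x y z|h X Y Z].
  have := congr1 (fun W => W.2) (h (x, 0) (y, 0) (z, 0)).
  by rewrite /= !(lb, lc, ld, le) !(addr0, add0r).
apply: dual_extP => /=; first exact: assoc0.
rewrite !lc !le !assoc0; apply: (eq_of_subr (h X.1 Y.1 Z.1)).
by abel.
Qed.

(** The three modules are kept apart so that the product and both actions are covered at once. *)
Lemma dual_bil_morph (E F G : lmodType K) (b b1 b1' : E -> F -> G)
    (p : E -> E) (q : F -> F) (r : G -> G) :
  bilinear_for *:%R *:%R b ->
  (forall X Y, dual_lin id r (dual_bil b b1 X Y) =
     dual_bil b b1' (dual_lin id p X) (dual_lin id q Y)) <->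
  (forall x y, b1 x y - b1' x y = b (p x) y + b x (q y) - r (b x y)).
Proof.
move=> /bilinear_rules lb; split=> [h x y|h X Y].
  have := congr1 (fun W => W.2) (h (x, 0) (y, 0)).
  rewrite /= !lb !addr0 => e; apply: (eq_of_subr e).
  by abel.
apply: dual_extP => //=.
rewrite !lb; apply: (eq_of_subr (h X.1 Y.1)).
by abel.
Qed.

Lemma dual_lin_morph (E F : lmodType K) (t t1 t1' : E -> F)
    (p : E -> E) (q : F -> F) :
  linear t ->
  (forall X, dual_lin t t1' (dual_lin id p X) = dual_lin id q (dual_lin t t1 X)) <->
  (forall x, t1 x - t1' x = t (p x) - q (t x)).
Proof.
move=> /linear_rules lt; split=> [h x|h X].
  have := congr1 (fun W => W.2) (h (x, 0)).
  rewrite /= !lt !addr0 => e; apply: (eq_of_subr (esym e)).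
  by abel.
apply: dual_extP => //=.
rewrite !lt; apply: (eq_of_subr (esym (h X.1))).
by abel.
Qed.

(** Since t squares to zero, id - tp is inverse to id + tp. *)
Lemma dual_lin_bijective (E : lmodType K) (p : E -> E) :
  bijective (dual_lin id p).
Proof.
exists (dual_lin id (fun x => - p x)) => X; apply: dual_extP => //=; abel.
Qed.

Lemma dual_lin_rota_baxter (A M : lmodType K) (S : rel_rota_baxter A M)
    (m1 : A -> A -> A) (l1 : A -> M -> M) (r1 : M -> A -> M) (t1 : M -> A) :
  (forall m n, dual_bil (rb_mul S) m1 (dual_lin (rb_op S) t1 m)
                                      (dual_lin (rb_op S) t1 n) =
     dual_lin (rb_op S) t1
       (dual_bil (rb_lact S) l1 (dual_lin (rb_op S) t1 m) n +
        dual_bil (rb_ract S) r1 m (dual_lin (rb_op S) t1 n))) <->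
  (forall m n, m1 (rb_op S m) (rb_op S n) +
      (rb_mul S (t1 m) (rb_op S n) + rb_mul S (rb_op S m) (t1 n)) =
    t1 (rb_lact S (rb_op S m) n + rb_ract S m (rb_op S n)) +
    rb_op S (l1 (rb_op S m) n + r1 m (rb_op S n) +
             (rb_lact S (t1 m) n + rb_ract S m (t1 n)))).
Proof.
have lt := linear_rules (rb_op_linear S).
have lm := bilinear_rules (rb_mul_bilinear S).
have ll := bilinear_rules (rb_lact_bilinear S).
have lr := bilinear_rules (rb_ract_bilinear S).
split=> [h m n|h X Y].
  have := congr1 (fun W => W.2) (h (m, 0) (n, 0)).
  rewrite /= !(lt, lm, ll, lr) !(addr0, add0r, lt) => e; apply: (eq_of_subr e).
  by abel.
apply: dual_extP => /=; first exact: rb_opE.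
rewrite !(lt, lm, ll, lr); apply: (eq_of_subr (h X.1 Y.1)).
(* The products still containing [X.2] or [Y.2] under [rb_op] cancel by the undeformed Rota-Baxter
   identity. *)
rewrite !lt !rb_opE !lt.
by abel.
Qed.

End DualMaps.

(** * Two-cochains in components *)

Lemma ord2P (T : Type) (v w : 'I_2 -> T) :
  v ord0 = w ord0 -> v ord_max = w ord_max -> v = w.
Proof.
move=> e0 e1; apply/funext => -[[|[|i]] lti] //.
  by rewrite (_ : Ordinal lti = ord0)//; apply/val_inj.
by rewrite (_ : Ordinal lti = ord_max)//; apply/val_inj.
Qed.

Section TwoCochains.
Variables (K : fieldType) (A M : lmodType K).
Local Notation V := (A * M)%type.

Definition bimap (m : A -> A -> A) (l : A -> M -> M) (r : M -> A -> M) :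
    ('I_2 -> V) -> V :=
  fun v => (m (v ord0).1 (v ord_max).1,
            l (v ord0).1 (v ord_max).2 + r (v ord0).2 (v ord_max).1).

Definition cochain2 m l r (t : M -> A) : cochain A M 2 :=
  (bimap m l r, fun u => t (u ord0)).

Definition pair2 (W : Type) (x y : W) : 'I_2 -> W := fun i => if i == ord0 then x else y.

Lemma multilinear2_bilinear (W W' : lmodType K) (f : ('I_2 -> W) -> W') :
  multilinear f -> bilinear_for *:%R *:%R (fun x y => f (pair2 x y)).
Proof.
move=> fl; split=> z a x y.
  have fE u : f (pair2 u z) = f (@dfwith _ _ (pair2 0 z) ord0 u).
    by congr f; apply: ord2P; rewrite ?dfwith_in ?dfwith_out.
  by rewrite !fE fl.
have fE u : f (pair2 z u) = f (@dfwith _ _ (pair2 z 0) ord_max u).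
  by congr f; apply: ord2P; rewrite ?dfwith_in ?dfwith_out.
by rewrite !fE fl.
Qed.

Lemma bilinear_multilinear2 (W W' : lmodType K) (b : W -> W -> W') :
  bilinear_for *:%R *:%R b -> multilinear (fun v : 'I_2 -> W => b (v ord0) (v ord_max)).
Proof.
move=> [bl br] v [[|[|i]] lti] // a x y.
  rewrite (_ : Ordinal lti = ord0); last exact/val_inj.
  by rewrite !dfwith_in !dfwith_out// bl.
rewrite (_ : Ordinal lti = ord_max); last exact/val_inj.
by rewrite !dfwith_in !dfwith_out// br.
Qed.

Lemma multilinear1P (W W' : lmodType K) (f : ('I_1 -> W) -> W') :
  multilinear f <-> exists2 h : W -> W', linear h & f = fun v : 'I_1 -> W => h (v ord0).
Proof.
split=> [fl|[h hl ->]].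
  exists (fun x => f (fun=> x)).
    move=> a x y; have fE u : f (fun=> u) = f (@dfwith _ _ (fun=> 0) ord0 u).
      by congr f; apply/funext => i; rewrite (ord1 i) dfwith_in.
    by rewrite !fE fl.
  by apply/funext => v; congr f; apply/funext => i; rewrite (ord1 i).
by move=> v i a x y; rewrite (ord1 i) !dfwith_in hl.
Qed.

(** The degree condition rebuilds f from its restrictions to A (x) A, A (x) M and M (x) A, which
    become the three bilinear components. *)
Lemma cochains2P (c : cochain A M 2) :
  cochains c <-> exists m l r t,
    [/\ [/\ bilinear_for *:%R *:%R m, bilinear_for *:%R *:%R l,
            bilinear_for *:%R *:%R r & linear t] &
        c = cochain2 m l r t].
Proof.
split=> [[]|[m [l [r [t [[ml ll rl tl] ->]]]]]].
  case: c => f P /= /multilinear2_bilinear [fl fr] f0 /multilinear1P[t tl ->].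
  exists (fun a b => (f (pair2 (inA M a) (inA M b))).1).
  exists (fun a y => (f (pair2 (inA M a) (inM A y))).2).
  exists (fun x b => (f (pair2 (inM A x) (inA M b))).2).
  exists t.
  have inAl : linear (@inA _ A M).
    by move=> a x y; rewrite /inA; congr pair; rewrite /= scaler0 addr0.
  have inMl : linear (@inM _ A M).
    by move=> a x y; rewrite /inM; congr pair; rewrite /= scaler0 addr0.
  split; last first.
    (* Index 0 of the sum has the element of M in the first slot, which is the right action; hence
       the commutation. *)
    congr pair; apply/funext => v; rewrite f0 big_ord_recr big_ord1 /= addrC.
    by congr pair; last congr (_ + _);
      [congr (f _).1|congr (f _).2|congr (f _).2]; apply: ord2P.
  split=> //; split=> z a x y; rewrite ?inAl ?inMl ?fl ?fr //.
split=> /=.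
- apply: (@bilinear_multilinear2 _ _
    (fun x y => (m x.1 y.1, l x.1 y.2 + r x.2 y.1))).
  have {}ml := bilinear_rules ml; have {}ll := bilinear_rules ll.
  have {}rl := bilinear_rules rl.
  split=> -[z1 z2] a [x1 x2] [y1 y2]; congr pair; rewrite /= ?(ml, ll, rl)//=.
    by rewrite scalerDr; abel.
  by rewrite scalerDr; abel.
- have {}ml := bilinear_rules ml; have {}ll := bilinear_rules ll.
  have {}rl := bilinear_rules rl.
  move=> v; rewrite big_ord_recr big_ord1 /bimap /= !(ml, ll, rl).
  by rewrite !addr0 !add0r addrC.
- by apply/multilinear1P; exists t.
Qed.

Lemma cochain2B m l r t m' l' r' t' :
  cochain2 m l r t - cochain2 m' l' r' t' =
  cochain2 (fun a b => m a b - m' a b) (fun a x => l a x - l' a x)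
    (fun x a => r x a - r' x a) (fun x => t x - t' x).
Proof.
congr pair; apply/funext => v //; congr pair => //=.
by abel.
Qed.

(** Evaluation at pairs of elements of A or M isolates each component; in the M-coordinate the other
    summand has a zero argument and vanishes. *)
Lemma cochain2_inj m l r t m' l' r' t' :
  bilinear_for *:%R *:%R l -> bilinear_for *:%R *:%R l' ->
  bilinear_for *:%R *:%R r -> bilinear_for *:%R *:%R r' ->
  cochain2 m l r t = cochain2 m' l' r' t' ->
  [/\ forall a b, m a b = m' a b, forall a x, l a x = l' a x,
      forall x a, r x a = r' x a & forall x, t x = t' x].
Proof.
move=> /bilinear_rules ll /bilinear_rules ll' /bilinear_rules rl /bilinear_rules rl'.
case=> e et.
have E x y := congr1 (fun f : ('I_2 -> V) -> V => f (pair2 x y)) e.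
split=> [a b|a x|x a|x].
- by have /= [] := E (a, 0) (b, 0).
- by have /= [_] := E (a, 0) (0, x); rewrite !(ll, ll', rl, rl') !addr0.
- by have /= [_] := E (0, x) (a, 0); rewrite !(ll, ll', rl, rl') !add0r.
- exact: (congr1 (fun f : ('I_1 -> M) -> A => f (fun=> x)) et).
Qed.

End TwoCochains.

(** * Gerstenhaber brackets in low degree *)

Section LowBrackets.
Variables (K : fieldType) (V : lmodType K).
Local Notation p2 := pair2.
Local Notation i_ k := (inord k).

Lemma gcirc11 (f g : ('I_2 -> V) -> V) (v : 'I_3 -> V) :
  gcirc (m := 1) (n := 1) f g v =
  f (p2 (g (p2 (v (i_ 0)) (v (i_ 1)))) (v (i_ 2))) -
  f (p2 (v (i_ 0)) (g (p2 (v (i_ 1)) (v (i_ 2))))).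
Proof.
rewrite /gcirc big_ord_recr big_ord1 /= expr0 scale1r expr1 scaleN1r.
by congr (f _ - f _); apply: ord2P => //=; congr g; apply: ord2P.
Qed.

Lemma gcirc10 (f : ('I_2 -> V) -> V) (g : ('I_1 -> V) -> V) (v : 'I_2 -> V) :
  gcirc (m := 1) (n := 0) f g v =
  f (p2 (g (fun=> v ord0)) (v ord_max)) + f (p2 (v ord0) (g (fun=> v ord_max))).
Proof.
have i0 : inord 0 = ord0 :> 'I_2 by apply/val_inj; rewrite /= inordK.
have i1 : inord 1 = ord_max :> 'I_2 by apply/val_inj; rewrite /= inordK.
rewrite /gcirc big_ord_recr big_ord1 /= !muln0 expr0 !scale1r.
have ordE (k : 'I_1) : v (inord (0 + k)) = v ord0 /\ v (inord (1 + k)) = v ord_max.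
  by rewrite (ord1 k) /= addn0 i0 i1.
congr (f _ + f _); apply: ord2P; rewrite /p2 /= ?i0 ?i1//.
  by congr g; apply/funext => k; case: (ordE k).
by congr g; apply/funext => k; case: (ordE k).
Qed.

Lemma gcirc01 (f : ('I_1 -> V) -> V) (g : ('I_2 -> V) -> V) (v : 'I_2 -> V) :
  gcirc (m := 0) (n := 1) f g v = f (fun=> g v).
Proof.
rewrite /gcirc big_ord1 /= expr0 scale1r; congr f; apply/funext => j.
rewrite (ord1 j) /=; congr g; apply/funext => k.
by congr v; apply/val_inj; rewrite /= inordK ?ltn_ord.
Qed.

(** For two binary maps the sign makes the bracket symmetric, so it is the polarisation of the
    associator. *)
Lemma gbracket11 (f g : ('I_2 -> V) -> V) (v : 'I_3 -> V) :
  let x := v (i_ 0) in let y := v (i_ 1) in let z := v (i_ 2) in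
  gbracket (m := 1) (n := 1) f g v =
  f (p2 (g (p2 x y)) z) - f (p2 x (g (p2 y z))) +
  (g (p2 (f (p2 x y)) z) - g (p2 x (f (p2 y z)))).
Proof.
move=> x y z; rewrite /gbracket !gcirc11 /= expr1 scaleN1r opprK.
have cE k : cast_ord (congr1 S (addnC 1 1)) k = k by apply/val_inj.
by rewrite !cE.
Qed.

(** The bracket with a unary map g measures how far g is from being a derivation of f. *)
Lemma gbracket10 (f : ('I_2 -> V) -> V) (g : ('I_1 -> V) -> V) (v : 'I_2 -> V) :
  gbracket (m := 1) (n := 0) f g v =
  f (p2 (g (fun=> v ord0)) (v ord_max)) + f (p2 (v ord0) (g (fun=> v ord_max))) -
  g (fun=> f v).
Proof.
rewrite /gbracket gcirc10 gcirc01 /= expr0 scale1r.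
by congr (_ - g _); apply/funext => j; congr f; apply/funext => k; congr v;
  apply/val_inj.
Qed.

End LowBrackets.

(** * Explicit cocycle and coboundary conditions *)

Section CocyclesAndCoboundaries.
Variables (K : fieldType) (A M : lmodType K) (S : rel_rota_baxter A M).
Local Notation V := (A * M)%type.
Local Notation mu := (rb_mul S).
Local Notation l := (rb_lact S).
Local Notation r := (rb_ract S).
Local Notation T := (rb_op S).

Let lm := bilinear_rules (rb_mul_bilinear S).
Let ll := bilinear_rules (rb_lact_bilinear S).
Let lr := bilinear_rules (rb_ract_bilinear S).
Let lT := linear_rules (rb_op_linear S).

Local Notation p2 := pair2.

(* The coefficients of t in the axioms of a relative Rota-Baxter algebra. *)
Definition infinitesimal_axioms (m1 : A -> A -> A) (l1 : A -> M -> M)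
    (r1 : M -> A -> M) (t1 : M -> A) : Prop :=
  [/\ forall a b c, m1 (mu a b) c + mu (m1 a b) c = m1 a (mu b c) + mu a (m1 b c),
      forall a b x, l1 (mu a b) x + l (m1 a b) x = l1 a (l b x) + l a (l1 b x),
      forall a x b, r1 (l a x) b + r (l1 a x) b = l1 a (r x b) + l a (r1 x b),
      forall x a b, r1 (r x a) b + r (r1 x a) b = r1 x (mu a b) + r x (m1 a b)
    & forall x y, m1 (T x) (T y) + (mu (t1 x) (T y) + mu (T x) (t1 y)) =
        t1 (l (T x) y + r x (T y)) +
        T (l1 (T x) y + r1 x (T y) + (l (t1 x) y + r x (t1 y)))].

(** Extended by zero, T and t1 vanish on A and take values in A, so their composites in either order
    are zero. This removes the remaining terms of the double bracket. *)
Lemma derived_bracket1 (t1 : M -> A) (u : 'I_2 -> M) :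
  linear t1 ->
  derived_bracket S (fun v : 'I_1 -> M => t1 (v ord0)) u =
  mu (t1 (u ord0)) (T (u ord_max)) + mu (T (u ord0)) (t1 (u ord_max)) -
  T (l (t1 (u ord0)) (u ord_max) + r (u ord0) (t1 (u ord_max))) -
  t1 (l (T (u ord0)) (u ord_max) + r (u ord0) (T (u ord_max))).
Proof.
move=> /linear_rules lt; rewrite /derived_bracket.
rewrite (gbracket10 (gbracket (@pi_map _ _ _ S) (@op_map _ _ _ S))).
rewrite !(gbracket10 (@pi_map _ _ _ S)).
rewrite /pi_map /op_map /extM /inA /inM /=.
rewrite !(lm, ll, lr, lT, lt, addr0, add0r, oppr0, subr0, sub0r).
by abel.
Qed.

Lemma Omega2 m1 l1 r1 (u : 'I_2 -> M) :
  bilinear_for *:%R *:%R l1 -> bilinear_for *:%R *:%R r1 ->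
  Omega S (bimap m1 l1 r1) u = 
  m1 (T (u ord0)) (T (u ord_max)) -
  T (l1 (T (u ord0)) (u ord_max) + r1 (u ord0) (T (u ord_max))).
Proof.
move=> /bilinear_rules ll1 /bilinear_rules lr1.
rewrite /Omega big_ord_recr big_ord1 /bimap /= sqrrN expr1n scale1r.
rewrite !(lm, ll, lr, lT, ll1, lr1, addr0, add0r).
by abel.
Qed.

(** An intermediate form: the first equation is the linearised associativity of the product on the
    direct sum of A and M, with the algebra and bimodule axioms not yet separated. *)
Lemma rb_diff2_eq0 m1 l1 r1 t1 : linear t1 ->
  bilinear_for *:%R *:%R l1 -> bilinear_for *:%R *:%R r1 ->
  rb_diff S (cochain2 m1 l1 r1 t1) = 0 <->
  (forall x y z : V,
     let p x y := pi_map S (p2 x y) in let f x y := bimap m1 l1 r1 (p2 x y) in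
     p (f x y) z + f (p x y) z = p x (f y z) + f x (p y z)) /\
  (forall x y, m1 (T x) (T y) + (mu (t1 x) (T y) + mu (T x) (t1 y)) =
        t1 (l (T x) y + r x (T y)) +
        T (l1 (T x) y + r1 x (T y) + (l (t1 x) y + r x (t1 y)))).
Proof.
move=> tl l1l r1l; have lt := linear_rules tl.
have bE (u : 'I_2 -> M) : (rb_diff S (cochain2 m1 l1 r1 t1)).2 u =
    (m1 (T (u ord0)) (T (u ord_max)) +
      (mu (t1 (u ord0)) (T (u ord_max)) + mu (T (u ord0)) (t1 (u ord_max)))) -
    (t1 (l (T (u ord0)) (u ord_max) + r (u ord0) (T (u ord_max))) +
     T (l1 (T (u ord0)) (u ord_max) + r1 (u ord0) (T (u ord_max)) +
        (l (t1 (u ord0)) (u ord_max) + r (u ord0) (t1 (u ord_max))))).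
  transitivity ((-1) ^+ 2 *: derived_bracket S (fun v : 'I_1 -> M => t1 (v ord0)) u +
                Omega S (bimap m1 l1 r1) u); first by [].
  rewrite Omega2// derived_bracket1// sqrrN expr1n scale1r !(lt, lT).
  by abel.
split=> [[e1 e2]|[h1 h2]].
  split=> [x y z p f|x y]; apply/eqP; rewrite -subr_eq0; apply/eqP.
    have /eqP := congr1 (fun g : ('I_3 -> V) -> V => g (fun i => nth 0 [:: x; y; z] i)) e1.
    rewrite /= scaleN1r oppr_eq0 gbracket11 /= !inordK// => /eqP /=.
    by move=> e; apply: (eq_of_subr e); abel.
  have := congr1 (fun g : ('I_2 -> M) -> A => g (pair2 x y)) e2.
  by have /= -> := bE (pair2 x y).
rewrite [LHS]surjective_pairing; congr pair; apply/funext => u; last first.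
  by rewrite bE h2 subrr.
rewrite /= gbracket11; apply/eqP; rewrite scaleN1r oppr_eq0; apply/eqP.
apply: (eq_of_subr (h1 (u (inord 0)) (u (inord 1)) (u (inord 2)))).
by abel.
Qed.

(** Triples with all entries in A give the algebra axiom, and triples with exactly one entry in M
    give one bimodule axiom for each position of that entry. *)
Lemma rb_diff2_eq0P m1 l1 r1 t1 :
  bilinear_for *:%R *:%R m1 ->
  bilinear_for *:%R *:%R l1 -> bilinear_for *:%R *:%R r1 -> linear t1 -> 
  rb_diff S (cochain2 m1 l1 r1 t1) = 0 <-> infinitesimal_axioms m1 l1 r1 t1.
Proof.
move=> m1l l1l r1l t1l; rewrite rb_diff2_eq0//.
have {}m1l := bilinear_rules m1l; have {}l1l := bilinear_rules l1l.
have {}r1l := bilinear_rules r1l.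
split=> [[h1 h2]|[e1 e2 e3 e4 e5]].
  have a3 x y z := congr1 (fun w => w.1) (h1 x y z).
  have b3 x y z := congr1 (fun w => w.2) (h1 x y z).
  split=> // [a b c|a b x|a x b|x a b].
  - have := a3 (a, 0) (b, 0) (c, 0); rewrite /= => e; apply: (eq_of_subr e); abel.
  - have := b3 (a, 0) (b, 0) (0, x).
    rewrite /= !(lm, ll, lr, m1l, l1l, r1l, addr0, add0r) => e.
    by apply: (eq_of_subr e); abel.
  - have := b3 (a, 0) (0, x) (b, 0).
    rewrite /= !(lm, ll, lr, m1l, l1l, r1l, addr0, add0r) => e.
    by apply: (eq_of_subr e); abel.
  - have := b3 (0, x) (a, 0) (b, 0).
    rewrite /= !(lm, ll, lr, m1l, l1l, r1l, addr0, add0r) => e.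
    by apply: (eq_of_subr e); abel.
split=> // -[a x] [b y] [c z]; congr pair => /=.
  by apply: (eq_of_subr (e1 a b c)); abel.
rewrite !(lm, ll, lr, m1l, l1l, r1l).
(* By trilinearity the M-coordinate splits according to the slot contributing its component in M:
   the third, the second, then the first. *)
apply: (eq_of_subr (congr2 +%R (congr2 +%R (e2 a b z) (e3 a y c)) (e4 x b c))).
by abel.
Qed.

Definition cochain1 (phi : A -> A) (psi : M -> M) : cochain A M 1 :=
  (fun v => (phi (v ord0).1, psi (v ord0).2), 0).

(** In degree one the degree condition says that the map is diagonal for the decomposition into A
    and M. *)
Lemma cochains1P (c : cochain A M 1) :
  cochains c <-> exists phi psi,
    [/\ linear phi, linear psi & c = cochain1 phi psi].
Proof.
split=> [[]|[phi [psi [lphi lpsi ->]]]].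
  case: c => f P /= /multilinear1P[h hl ->] f0 ->.
  have hE v : h v = ((h (v.1, 0)).1, (h (0, v.2)).2).
    by rewrite [LHS](f0 (fun=> v)) big_ord1.
  exists (fun a => (h (a, 0)).1), (fun x => (h (0, x)).2); split.
  - move=> a x y; rewrite -[_ *: _ in RHS]/((a *: h (x, 0)).1).
    rewrite -[RHS]/((a *: h (x, 0) + h (y, 0)).1) -hl; congr (h _).1.
    by congr pair; rewrite /= scaler0 addr0.
  - move=> a x y.
    rewrite -[RHS]/((a *: h (0, x) + h (0, y)).2) -hl; congr (h _).2.
    by congr pair; rewrite /= scaler0 addr0.
  - by congr pair; apply/funext => v; rewrite hE.
split=> //=.
- apply/multilinear1P; exists (fun x : V => (phi x.1, psi x.2)) => //.
  by move=> a x y; rewrite /= lphi lpsi.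
- have {}lphi := linear_rules lphi; have {}lpsi := linear_rules lpsi.
  by move=> v; rewrite big_ord1 /=.
Qed.

Lemma rb_diff1E phi psi : linear phi -> linear psi ->
  rb_diff S (cochain1 phi psi) =
  cochain2 (fun a b => mu (phi a) b + mu a (phi b) - phi (mu a b))
    (fun a x => l (phi a) x + l a (psi x) - psi (l a x))
    (fun x a => r (psi x) a + r x (phi a) - psi (r x a))
    (fun x => T (psi x) - phi (T x)).
Proof.
move=> /linear_rules lphi /linear_rules lpsi.
rewrite /rb_diff /cochain2; congr pair; apply/funext => v.
  rewrite expr0 scale1r gbracket10 /pi_map /bimap; congr pair => //=.
  by rewrite !lpsi; abel.
(* With P absent the derived bracket is 0, and the sign in [Omega] turns its term around. *)
rewrite /= scaler0 add0r /Omega big_ord1 /= expr1 scaleN1r.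
by abel.
Qed.

Lemma cohomologous2P m1 l1 r1 t1 m1' l1' r1' t1' :
  bilinear_for *:%R *:%R l1 -> bilinear_for *:%R *:%R r1 ->
  bilinear_for *:%R *:%R l1' -> bilinear_for *:%R *:%R r1' ->
  cohomologous S (cochain2 m1 l1 r1 t1) (cochain2 m1' l1' r1' t1') <->
  exists phi psi, [/\ linear phi /\ linear psi,
    forall a b, m1 a b - m1' a b = mu (phi a) b + mu a (phi b) - phi (mu a b),
    forall a x, l1 a x - l1' a x = l (phi a) x + l a (psi x) - psi (l a x),
    forall x a, r1 x a - r1' x a = r (psi x) a + r x (phi a) - psi (r x a)
  & forall x, t1 x - t1' x = T (psi x) - phi (T x)].
Proof.
move=> l1l r1l l1'l r1'l.
have bilB (E F G : lmodType K) (b b' : E -> F -> G) :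
    bilinear_for *:%R *:%R b -> bilinear_for *:%R *:%R b' ->
    bilinear_for *:%R *:%R (fun x y => b x y - b' x y).
  move=> /bilinear_rules bl /bilinear_rules bl'.
  by split=> z a x y; rewrite /= !(bl, bl') scalerDr scalerN; abel.
rewrite /cohomologous cochain2B; split.
  case=> c /cochains1P[phi [psi [lphi lpsi ->]]].
  rewrite rb_diff1E// => /esym/cochain2_inj[].
  - exact: bilB.
  - have {}lphi := linear_rules lphi; have {}lpsi := linear_rules lpsi.
    by split=> z a x y; rewrite /= !(ll, lphi, lpsi) !(scalerDr, scalerN); abel.
  - exact: bilB.
  - have {}lphi := linear_rules lphi; have {}lpsi := linear_rules lpsi.
    by split=> z a x y; rewrite /= !(lr, lphi, lpsi) !(scalerDr, scalerN); abel.
  by move=> *; exists phi, psi; split.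
case=> phi [psi [[lphi lpsi] e1 e2 e3 e4]].
exists (cochain1 phi psi); first by apply/cochains1P; exists phi, psi.
by rewrite rb_diff1E//; congr cochain2; do 2?apply/funext => ? //.
Qed.

End CocyclesAndCoboundaries.

(** * Deformations and their infinitesimals *)

Section DeformationsAndCocycles.
Variables (K : fieldType) (A M : lmodType K) (S : rel_rota_baxter A M).
Implicit Types D : inf_deformation S.
Local Notation one := (dual_tensor 1).

Definition defo_mul D (a b : A) : A := (rb_mul D (one a) (one b)).2.
Definition defo_lact D (a : A) (x : M) : M := (rb_lact D (one a) (one x)).2.
Definition defo_ract D (x : M) (a : A) : M := (rb_ract D (one x) (one a)).2.
Definition defo_op D (x : M) : A := (rb_op D (one x)).2.

Lemma infinitesimalE D : infinitesimal D =
  cochain2 (defo_mul D) (defo_lact D) (defo_ract D) (defo_op D).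
Proof. by []. Qed.

Lemma defo_mulE D : rb_mul D = dual_bil (rb_mul S) (defo_mul D).
Proof.
case: (defo_eps D) => _ em _ el er.
apply: dual_bilE => [|X Y]; first exact: rb_mul_bilinear.
exact: em.
Qed.

Lemma defo_lactE D : rb_lact D = dual_bil (rb_lact S) (defo_lact D).
Proof.
case: (defo_eps D) => _ em _ el er.
apply: dual_bilE => [|X Y]; first exact: rb_lact_bilinear.
exact: el.
Qed.

Lemma defo_ractE D : rb_ract D = dual_bil (rb_ract S) (defo_ract D).
Proof.
case: (defo_eps D) => _ em _ el er.
apply: dual_bilE => [|X Y]; first exact: rb_ract_bilinear.
exact: er.
Qed.

Lemma defo_opE D : rb_op D = dual_lin (rb_op S) (defo_op D).
Proof.
case: (defo_eps D) => _ _ et _ _.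
apply: dual_linE => [|X]; first exact: rb_op_linear.
exact/esym/et.
Qed.

Lemma defo_mul_bilinear D : bilinear_for *:%R *:%R (defo_mul D).
Proof. exact: bilinear_dual_part (rb_mul_bilinear D). Qed.

Lemma defo_lact_bilinear D : bilinear_for *:%R *:%R (defo_lact D).
Proof. exact: bilinear_dual_part (rb_lact_bilinear D). Qed.

Lemma defo_ract_bilinear D : bilinear_for *:%R *:%R (defo_ract D).
Proof. exact: bilinear_dual_part (rb_ract_bilinear D). Qed.

Lemma defo_op_linear D : linear (defo_op D).
Proof. exact: linear_dual_part (rb_op_linear D). Qed.

Let mulB := rb_mul_bilinear S.
Let lactB := rb_lact_bilinear S.
Let ractB := rb_ract_bilinear S.

Lemma infinitesimal_axioms_dual m1 l1 r1 t1 :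
  infinitesimal_axioms S m1 l1 r1 t1 <->
  let mu := dual_bil (rb_mul S) m1 in let l := dual_bil (rb_lact S) l1 in
  let r := dual_bil (rb_ract S) r1 in let T := dual_lin (rb_op S) t1 in
  [/\ forall a b c, mu (mu a b) c = mu a (mu b c),
      forall a b x, l (mu a b) x = l a (l b x),
      forall a x b, r (l a x) b = l a (r x b),
      forall x a b, r (r x a) b = r x (mu a b)
    & forall x y, mu (T x) (T y) = T (l (T x) y + r x (T y))].
Proof.
have [m0 m0'] := dual_bil_assoc m1 m1 m1 m1 mulB mulB mulB mulB (rb_mulA S).
have [l0 l0'] := dual_bil_assoc m1 l1 l1 l1 lactB lactB mulB lactB (rb_lactA S).
have [c0 c0'] := dual_bil_assoc l1 r1 r1 l1 ractB lactB lactB ractB (rb_lractA S).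
have [r0 r0'] := dual_bil_assoc r1 r1 m1 r1 ractB ractB ractB mulB (rb_ractA S).
have [t0 t0'] := dual_lin_rota_baxter S m1 l1 r1 t1.
by split=> -[em el ec er et]; split; auto.
Qed.

Lemma infinitesimal_axioms_defo D :
  infinitesimal_axioms S (defo_mul D) (defo_lact D) (defo_ract D) (defo_op D).
Proof.
apply/infinitesimal_axioms_dual; rewrite -defo_mulE -defo_lactE -defo_ractE -defo_opE.
by split; [exact: rb_mulA|exact: rb_lactA|exact: rb_lractA|exact: rb_ractA|exact: rb_opE].
Qed.

Lemma infinitesimal_cocycle D : cocycles S (infinitesimal D).
Proof.
have mB := defo_mul_bilinear D; have lB := defo_lact_bilinear D.
have rB := defo_ract_bilinear D; have tL := defo_op_linear D.
split; rewrite infinitesimalE.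
  apply/cochains2P; exists (defo_mul D), (defo_lact D), (defo_ract D), (defo_op D).
  by split.
by apply/rb_diff2_eq0P => //; apply: infinitesimal_axioms_defo.
Qed.

(** The maps of the cocycle serve as coefficients of t: the cocycle equations are exactly the axioms
    for the resulting structure over the dual numbers. *)
Lemma infinitesimal_surjective (c : cochain A M 2) :
  cocycles S c -> exists D, infinitesimal D = c.
Proof.
case=> /cochains2P[m1 [l1 [r1 [t1 [[m1B l1B r1B t1L] ->]]]]].
move=> /rb_diff2_eq0P - /(_ m1B l1B r1B t1L).
move=> /infinitesimal_axioms_dual[em el ec er et].
pose D0 := RelRotaBaxter (dual_bil_bilinear mulB m1B) (dual_bil_bilinear lactB l1B)
  (dual_bil_bilinear ractB r1B) (dual_lin_linear (rb_op_linear S) t1L) em el ec er et.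
have D0eps : rb_morphism D0 (rb_aug S) (@dual_eps K A) (@dual_eps K M).
  by split=> //; split=> a x y.
exists (InfDeformation D0eps); rewrite infinitesimalE.
have bm := bilinear_rules mulB; have bl := bilinear_rules lactB.
have br := bilinear_rules ractB; have lt := linear_rules (rb_op_linear S).
congr cochain2; do ?apply/funext => ?;
  by rewrite /defo_mul /defo_lact /defo_ract /defo_op !dual_oneE /=
     ?(bm, bl, br, lt) !addr0.
Qed.

(** Compatibility with the augmentation fixes the constant part to be the identity. *)
Lemma dual_lin_of_eps (E : lmodType K) (h : dual_ext E -> dual_ext E) :
  linear h -> (forall X, dual_eps (h X) = dual_eps X) ->
  exists2 p : E -> E, linear p & h = dual_lin id p.
Proof.
move=> hl he; exists (fun x => (h (one x)).2); first exact: linear_dual_part.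
exact: dual_linE.
Qed.

Lemma rb_morphism_dual D D' (phi : A -> A) (psi : M -> M) :
  linear phi -> linear psi ->
  rb_morphism D D' (dual_lin id phi) (dual_lin id psi) <->
  [/\ forall a b, defo_mul D a b - defo_mul D' a b =
        rb_mul S (phi a) b + rb_mul S a (phi b) - phi (rb_mul S a b),
      forall a x, defo_lact D a x - defo_lact D' a x =
        rb_lact S (phi a) x + rb_lact S a (psi x) - psi (rb_lact S a x),
      forall x a, defo_ract D x a - defo_ract D' x a =
        rb_ract S (psi x) a + rb_ract S x (phi a) - psi (rb_ract S x a)
    & forall x, defo_op D x - defo_op D' x =
        rb_op S (psi x) - phi (rb_op S x)].
Proof.
move=> phiL psiL; rewrite /rb_morphism !defo_mulE !defo_lactE !defo_ractE !defo_opE.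
have [m0 m0'] := dual_bil_morph (defo_mul D) (defo_mul D') phi phi phi mulB.
have [l0 l0'] := dual_bil_morph (defo_lact D) (defo_lact D') phi psi psi lactB.
have [r0 r0'] := dual_bil_morph (defo_ract D) (defo_ract D') psi phi psi ractB.
have [t0 t0'] := dual_lin_morph (defo_op D) (defo_op D') psi phi (rb_op_linear S).
split=> [[_ em et el er]|[em el er et]]; first by split; auto.
split; auto; split; exact: dual_lin_linear.
Qed.

(** An equivalence has the form (id + t phi, id + t psi), which is automatically bijective. Being a
    morphism then amounts to the equations of [cohomologous2P]. *)
Lemma defo_equivE D D' :
  defo_equiv D D' <-> cohomologous S (infinitesimal D) (infinitesimal D').
Proof.
have lB := defo_lact_bilinear D; have rB := defo_ract_bilinear D.
have lB' := defo_lact_bilinear D'; have rB' := defo_ract_bilinear D'.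
rewrite !infinitesimalE cohomologous2P//; split.
  case=> Phi [Psi [[mor _ _] ePhi ePsi]].
  have [[PhiL PsiL] _ _ _ _] := mor.
  have [phi phiL PhiE] := dual_lin_of_eps PhiL ePhi.
  have [psi psiL PsiE] := dual_lin_of_eps PsiL ePsi.
  move: mor; rewrite PhiE PsiE rb_morphism_dual// => -[em el er et].
  by exists phi, psi.
case=> phi [psi [[phiL psiL] em el er et]].
exists (dual_lin id phi), (dual_lin id psi); split=> //.
by split; [apply/rb_morphism_dual|exact: dual_lin_bijective..].
Qed.

End DeformationsAndCocycles.

(** * Passage to equivalence classes *)

Lemma eq_classP (X : Type) (Z : set X) (E : X -> X -> Prop) (x y : X) :
  (forall x, E x x) -> (forall x y, E x y -> E y x) ->
  (forall x y z, E x y -> E y z -> E x z) ->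
  Z y -> eq_class Z E x = eq_class Z E y <-> E x y.
Proof.
move=> refl sym trans Zy; split=> [e|exy].
  have : eq_class Z E y y by split.
  by rewrite -e => -[].
apply/funext => z; apply/propext; split=> -[Zz h]; split=> //.
  exact: trans (sym _ _ exy) h.
exact: trans exy h.
Qed.

Section CohomologousEquivalence.
Variables (K : fieldType) (A M : lmodType K) (S : rel_rota_baxter A M).
Local Notation coho := (@cohomologous _ _ _ S 2).

(** Closure under subtraction yields reflexivity, symmetry and transitivity of [cohomologous]. It
    comes from the additivity of the explicit formula [rb_diff1E] in the pair (phi, psi). *)
Lemma coboundaries2B (c c' : cochain A M 2) :
  coboundaries S c -> coboundaries S c' -> coboundaries S (c - c').
Proof.
move=> [_ /cochains1P[phi [psi [phiL psiL ->]]] <-].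
move=> [_ /cochains1P[phi' [psi' [phiL' psiL' ->]]] <-].
have subL (E F : lmodType K) (h h' : E -> F) :
    linear h -> linear h' -> linear (fun x => h x - h' x).
  move=> /linear_rules hl /linear_rules hl' a x y.
  by rewrite !(hl, hl') scalerDr scalerN; abel.
exists (cochain1 (fun a => phi a - phi' a) (fun x => psi x - psi' x)).
  by apply/cochains1P; do 2!eexists; split; last reflexivity; apply: subL.
rewrite !rb_diff1E//; [|exact: subL..].
have lm := bilinear_rules (rb_mul_bilinear S).
have ll := bilinear_rules (rb_lact_bilinear S).
have lr := bilinear_rules (rb_ract_bilinear S).
have lT := linear_rules (rb_op_linear S).
by rewrite cochain2B; congr cochain2; do ?apply/funext => ?;
  rewrite !(lm, ll, lr, lT); abel.
Qed.

Lemma coboundaries2_0 : coboundaries S (0 : cochain A M 2).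
Proof.
have z (E F : lmodType K) : linear (fun _ : E => 0 : F).
  by move=> a x y; rewrite scaler0 addr0.
have c : coboundaries S (rb_diff S (cochain1 (fun _ : A => 0 : A) (fun _ : M => 0 : M))).
  exists (cochain1 (fun=> 0) (fun=> 0)) => //.
  by apply/cochains1P; exists (fun=> 0), (fun=> 0); split.
by have := coboundaries2B c c; rewrite subrr.
Qed.

Lemma cohomologous2_refl c : coho c c.
Proof. by rewrite /cohomologous subrr; exact: coboundaries2_0. Qed.

Lemma cohomologous2_sym c c' : coho c c' -> coho c' c.
Proof.
move=> h; have := coboundaries2B coboundaries2_0 h.
by rewrite /cohomologous sub0r opprB.
Qed.

Lemma cohomologous2_trans c c' c'' : coho c c' -> coho c' c'' -> coho c c''.
Proof.
move=> h /cohomologous2_sym h'; have := coboundaries2B h h'.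
by rewrite /cohomologous opprB addrA subrK.
Qed.

End CohomologousEquivalence.

Theorem theorem5p4 (K : fieldType) (charK0 : [pchar K] =i pred0)
    (A M : lmodType K) (S : rel_rota_baxter A M) :
  exists F : deformation_classes S -> cohomology S 2,
    bijective F /\
    forall D : inf_deformation S,
      exists cZ : cocycles S (infinitesimal D),
        F (defo_class D) = coho_class cZ.
Proof.
have cohoP (c c' : cochain A M 2) : cocycles S c' ->
    eq_class (@cocycles K A M S 2) (@cohomologous K A M S 2) c =
    eq_class (@cocycles K A M S 2) (@cohomologous K A M S 2) c' <->
    cohomologous S c c'.
  apply: eq_classP; [exact: cohomologous2_refl|exact: cohomologous2_sym|].
  exact: cohomologous2_trans.
have defoP (D D' : inf_deformation S) :
    eq_class setT (@defo_equiv K A M S) D = eq_class setT (@defo_equiv K A M S) D' <->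
    cohomologous S (infinitesimal D) (infinitesimal D').
  (* Equivalence of deformations inherits the three laws from [cohomologous] through
     [defo_equivE]. *)
  rewrite -defo_equivE; apply: eq_classP => //.
  - by move=> ?; apply/defo_equivE/cohomologous2_refl.
  - by move=> ? ? /defo_equivE ?; apply/defo_equivE/cohomologous2_sym.
  - move=> ? ? ? /defo_equivE h /defo_equivE h'; apply/defo_equivE.
    exact: cohomologous2_trans h h'.
have rep (C : deformation_classes S) : {D | C = defo_class D}.
  by apply: cid; case: C => C p; have [D _ CE] := p; exists D; apply: eq_exist.
pose F C := coho_class (infinitesimal_cocycle (sval (rep C))).
(* The map does not depend on the chosen representative: another deformation in the same class has a
   cohomologous infinitesimal. *)
have FE D : F (defo_class D) = coho_class (infinitesimal_cocycle D).
  apply: eq_exist; apply/cohoP; first exact: infinitesimal_cocycle.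
  exact/defoP/esym/(congr1 sval (svalP (rep (defo_class D)))).
exists F; split; last by move=> D; exists (infinitesimal_cocycle D).
have inv (C : cohomology S 2) : {D | C = coho_class (infinitesimal_cocycle D)}.
  apply: cid; case: C => C p; have [c cZ CE] := p.
  by have [D Dc] := infinitesimal_surjective cZ; exists D; apply: eq_exist; rewrite Dc.
exists (fun C => defo_class (sval (inv C))) => C; last first.
  by rewrite FE -(svalP (inv C)).
(* Injectivity: the deformation chosen from [F C] and the representative of [C] have cohomologous
   infinitesimals, hence are equivalent. *)
rewrite [RHS](svalP (rep C)); apply/eq_exist/defoP/cohomologous2_sym/cohoP.
  exact: infinitesimal_cocycle.
exact: (congr1 sval (svalP (inv (F C)))).
Qed.
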